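(* Let $G$ be a countable group and $\mathcal F\subset\mathcal P_G$ a Borel left-invariant lower family, where $\mathcal P_G$ is identified with the compact metrizable space $2^G$. Then: (1) for every ordinal $\alpha<\omega_1$ the family $\tau^\alpha(\mathcal F)$ is Borel in $\mathcal P_G$; (2) the family $\tau^*(\mathcal F)=\tau^{<\omega_1}(\mathcal F)$ is coanalytic; (3) if $\tau^*(\mathcal F)\ne\tau^\alpha(\mathcal F)$ for all $\alpha<\omega_1$, then $\tau^*(\mathcal F)$ is not Borel in $\mathcal P_G$.
   Context: Subsets $A\subset G$ are identified with their characteristic functions in $2^G$ (product topology). Left-invariant: $xF\in\mathcal F$ for $F\in\mathcal F$, $x\in G$; lower: closed under subsets. $\tau(\mathcal F)=\{A\subset G: xA\cap yA\in\mathcal F$ for all distinct $x,y\in G\}$, $\tau^0(\mathcal F)=\mathcal F$, $\tau^{<\alpha}(\mathcal F)=\bigcup_{\beta<\alpha}\tau^\beta(\mathcal F)$, $\tau^\alpha(\mathcal F)=\tau(\tau^{<\alpha}(\mathcal F))$ for $\alpha>0$; $\tau^*(\mathcal F)$ is the smallest family $\tilde{\mathcal F}\supset\mathcal F$ with $\tau(\tilde{\mathcal F})=\tilde{\mathcal F}$. A subset of a Polish space is analytic if it is a continuous image of a Polish space, coanalytic if its complement is analytic. *)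

(* Defs.v *)
From Stdlib Require Import Reals List.
Open Scope R_scope.

Definition is_group {G : Type} (mul : G -> G -> G) (one : G) (inv : G -> G) : Prop :=
  (forall x y z, mul x (mul y z) = mul (mul x y) z) /\
  (forall x, mul one x = x) /\
  (forall x, mul (inv x) x = one).

Definition countable_type (G : Type) : Prop :=
  exists c : G -> nat, forall x y, c x = c y -> x = y.

(* Subsets of G are their characteristic functions (points of 2^G);
   families are subsets of 2^G. *)
Definition gfamily (G : Type) := (G -> bool) -> Prop.

Definition same_family {G : Type} (F1 F2 : gfamily G) : Prop :=
  forall A, F1 A <-> F2 A.

Definition subfamily {G : Type} (F1 F2 : gfamily G) : Prop :=
  forall A, F1 A -> F2 A.

Definition translate {G : Type} (mul : G -> G -> G) (inv : G -> G)
  (x : G) (A : G -> bool) : G -> bool := fun g => A (mul (inv x) g).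

Definition inter {G : Type} (A B : G -> bool) : G -> bool := fun g => andb (A g) (B g).

Definition left_invariant {G : Type} (mul : G -> G -> G) (inv : G -> G) (F : gfamily G) : Prop :=
  forall A x, F A -> F (translate mul inv x A).

Definition lower {G : Type} (F : gfamily G) : Prop :=
  forall A B, F A -> (forall g, B g = true -> A g = true) -> F B.

Definition tau {G : Type} (mul : G -> G -> G) (inv : G -> G) (F : gfamily G) : gfamily G :=
  fun A => forall x y, x <> y -> F (inter (translate mul inv x A) (translate mul inv y A)).

(* Countable ordinals (< omega_1) as Brouwer trees with their usual order. *)
Inductive Ord : Type :=
| OZ : Ord
| OS : Ord -> Ord
| OL : (nat -> Ord) -> Ord.

Inductive ole : Ord -> Ord -> Prop :=
| ole_Z b : ole OZ b
| ole_S a b : olt a b -> ole (OS a) b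
| ole_L f b : (forall n, ole (f n) b) -> ole (OL f) b
with olt : Ord -> Ord -> Prop :=
| olt_S a b : ole a b -> olt a (OS b)
| olt_L a f n : olt a (f n) -> olt a (OL f).

(* InTau mul inv F alpha A  <->  A ∈ tau^alpha(F), where
   tau^0(F) = F and tau^alpha(F) = tau(tau^{<alpha}(F)) for alpha > 0,
   tau^{<alpha}(F) = union_{beta < alpha} tau^beta(F). *)
Inductive InTau {G : Type} (mul : G -> G -> G) (inv : G -> G) (F : gfamily G)
  : Ord -> (G -> bool) -> Prop :=
| InTau_zero alpha A : ole alpha OZ -> F A -> InTau mul inv F alpha A
| InTau_pos alpha A : olt OZ alpha ->
    (forall x y, x <> y ->
       exists beta, olt beta alpha /\
         InTau mul inv F beta (inter (translate mul inv x A) (translate mul inv y A))) ->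
    InTau mul inv F alpha A.

Definition tau_iter {G : Type} (mul : G -> G -> G) (inv : G -> G) (F : gfamily G)
  (alpha : Ord) : gfamily G := InTau mul inv F alpha.

Definition tau_omega1 {G : Type} (mul : G -> G -> G) (inv : G -> G) (F : gfamily G) : gfamily G :=
  fun A => exists alpha, InTau mul inv F alpha A.

Definition is_tau_star {G : Type} (mul : G -> G -> G) (inv : G -> G) (F T : gfamily G) : Prop :=
  subfamily F T /\ same_family (tau mul inv T) T /\
  (forall T', subfamily F T' -> same_family (tau mul inv T') T' -> subfamily T T').

Definition open2 {G : Type} (U : gfamily G) : Prop :=
  forall A, U A -> exists l : list G,
    forall B, (forall g, In g l -> B g = A g) -> U B.

Inductive Borel {G : Type} : gfamily G -> Prop :=
| Borel_open U : open2 U -> Borel U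
| Borel_compl S : Borel S -> Borel (fun A => ~ S A)
| Borel_union (S : nat -> gfamily G) : (forall n, Borel (S n)) ->
    Borel (fun A => exists n, S n A)
| Borel_ext S T : Borel S -> same_family S T -> Borel T.

Definition is_metric {X : Type} (d : X -> X -> R) : Prop :=
  (forall x y, d x y = 0 <-> x = y) /\
  (forall x y, d x y = d y x) /\
  (forall x y z, d x z <= d x y + d y z).

Definition complete_metric {X : Type} (d : X -> X -> R) : Prop :=
  forall u : nat -> X,
    (forall eps, eps > 0 -> exists N, forall m n, (N <= m)%nat -> (N <= n)%nat ->
        d (u m) (u n) < eps) ->
    exists l, forall eps, eps > 0 -> exists N, forall n, (N <= n)%nat -> d (u n) l < eps.

Definition separable_metric {X : Type} (d : X -> X -> R) : Prop :=
  exists D : X -> Prop,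
    (exists c : X -> nat, forall x y, D x -> D y -> c x = c y -> x = y) /\
    (forall x eps, eps > 0 -> exists y, D y /\ d x y < eps).

Definition polish {X : Type} (d : X -> X -> R) : Prop :=
  is_metric d /\ complete_metric d /\ separable_metric d.

Definition continuous_to2 {X G : Type} (d : X -> X -> R) (f : X -> G -> bool) : Prop :=
  forall x g, exists eps, eps > 0 /\ forall y, d x y < eps -> f y g = f x g.

Definition analytic {G : Type} (S : gfamily G) : Prop :=
  exists (X : Type) (d : X -> X -> R) (f : X -> G -> bool),
    polish d /\ continuous_to2 d f /\
    forall A, S A <-> exists x, forall g, f x g = A g.

Definition coanalytic {G : Type} (S : gfamily G) : Prop :=
  analytic (fun A => ~ S A).

(* Main.v *)
Require Import Defs.
From Stdlib Require Import Reals List.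
From Stdlib Require Import Arith Lra Lia Cantor Classical ClassicalEpsilon FunctionalExtensionality.

(** A set [A] lies outside [tau^*(F)] exactly when some infinite sequence of pairs
    [x_i <> y_i] produces, through [A_0 = A] and [A_(i+1) = x_i A_i ∩ y_i A_i], only sets outside
    [F]. The Borel complement of [F] being a projection of a closed set, these sequences, together
    with witnesses of [A_i ∉ F], form a Polish space projecting onto the complement of [tau^*(F)].

    For (3), apply the Kunen-Martin boundedness argument. If [tau^*(F)] were Borel, it would also be
    a projection of a closed set, and the finite approximations of configurations (a set, a witness
    that it lies in [tau^*(F)], a sequence of pairs, witnesses that the iterates avoid [F]) would
    form a countable tree. An infinite branch would give, in the limit, a member of [tau^*(F)] that
    is not in [tau^*(F)]; so the tree is well-founded, and its countable rank bounds the level at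
    which every member of [tau^*(F)] appears. *)

Local Open Scope nat_scope.

(** * Choice principles and infinite descent *)

Lemma choice_fun {A B : Type} (R : A -> B -> Prop) :
  (forall a, exists b, R a b) -> exists f, forall a, R a (f a).
Proof.
  intros H.
  exists (fun a => proj1_sig (constructive_indefinite_description _ (H a))).
  intros a. exact (proj2_sig (constructive_indefinite_description _ (H a))).
Qed.

Lemma dependent_choice {A : Type} (P : A -> Prop) (R : A -> A -> Prop) (a : A) :
  P a -> (forall x, P x -> exists y, P y /\ R x y) ->
  exists f : nat -> A, f 0 = a /\ forall n, P (f n) /\ R (f n) (f (S n)).
Proof.
  intros Pa H.
  destruct (choice_fun (fun (x y : {x | P x}) => R (proj1_sig x) (proj1_sig y))) as [h Hh].
  { intros [x Px]. destruct (H x Px) as [y [Py Rxy]]. exists (exist _ y Py). exact Rxy. }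
  exists (fun n => proj1_sig (Nat.iter n h (exist _ a Pa))).
  split; [reflexivity|]. intros n. split.
  - exact (proj2_sig (Nat.iter n h (exist _ a Pa))).
  - apply Hh.
Qed.

Lemma not_Acc_descending {A : Type} (R : A -> A -> Prop) (a : A) :
  ~ Acc R a -> exists f : nat -> A, f 0 = a /\ forall n, R (f (S n)) (f n).
Proof.
  intros Ha.
  destruct (dependent_choice (fun x => ~ Acc R x) (fun x y => R y x) a Ha) as [f [f0 Hf]].
  - intros x Hx. apply NNPP. intros N. apply Hx. constructor. intros y Ryx.
    apply NNPP. intros Hy. apply N. exists y. split; assumption.
  - exists f. split; [exact f0|]. intros n. apply (proj2 (Hf n)).
Qed.

Lemma bounded_below (h : nat -> nat) (n : nat) :
  exists N, forall k, k <= n -> h k <= N.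
Proof.
  induction n as [|n [N HN]].
  - exists (h 0). intros k Hk. replace k with 0 by lia. lia.
  - exists (N + h (S n)). intros k Hk.
    destruct (Nat.eq_dec k (S n)) as [->|ne]; [lia|]. specialize (HN k). lia.
Qed.

(** * Countable ordinals *)

Scheme ole_mut := Induction for ole Sort Prop
with olt_mut := Induction for olt Sort Prop.

Lemma not_olt_OZ a : ~ olt a OZ.
Proof. intros H; inversion H. Qed.

(** The rules for [ole] decompose its left argument until only strict comparisons with [b] remain,
    and these transfer to [c]. *)
Lemma ole_of_olt (b c : Ord) :
  (forall a, olt a b -> olt a c) -> forall a, ole a b -> ole a c.
Proof.
  intros H a. induction a as [|a _|f IH]; intros Hab.
  - constructor.
  - inversion Hab; subst. constructor. auto.
  - inversion Hab; subst. constructor. auto.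
Qed.

Lemma olt_ole_trans a b c : olt a b -> ole b c -> olt a c.
Proof.
  intros Hab Hbc. revert a Hab.
  (* Mutual induction on the derivation of [ole b c]; the companion claim for a strict derivation
     carries [ole a b] to [olt a c]. *)
  apply (ole_mut (fun b c _ => forall a, olt a b -> olt a c)
                 (fun b c _ => forall a, ole a b -> olt a c)); try assumption.
  - intros c' a Ha. destruct (not_olt_OZ _ Ha).
  - intros b' c' _ IH a Ha. inversion Ha; subst. auto.
  - intros f c' _ IH a Ha. inversion Ha; subst. eauto.
  - intros b' c' _ IH a Ha. constructor. exact (ole_of_olt _ _ IH _ Ha).
  - intros b' f n _ IH a Ha. apply olt_L with n. auto.
Qed.

Lemma ole_refl a : ole a a.
Proof.
  induction a as [|a IH|f IH].
  - constructor.
  - constructor. constructor. exact IH.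
  - constructor. intros n. apply ole_of_olt with (f n); [|apply IH].
    intros b Hb. apply olt_L with n. exact Hb.
Qed.

Lemma ole_OL (f : nat -> Ord) n : ole (f n) (OL f).
Proof. apply ole_of_olt with (f n); [intros a; apply olt_L|apply ole_refl]. Qed.

(** Being zero depends on the order and not on the constructor, since a limit of zeros is again
    zero. *)
Lemma OZ_or_pos a : ole a OZ \/ olt OZ a.
Proof.
  induction a as [|a _|f IH].
  - left. constructor.
  - right. constructor. constructor.
  - destruct (classic (exists n, olt OZ (f n))) as [[n Hn]|N].
    + right. apply olt_L with n. exact Hn.
    + left. constructor. intros n. destruct (IH n) as [H|H]; [exact H|].
      destruct N. exists n. exact H.
Qed.

(** * Polish metrics from separating sequences of equivalence relations *)

Lemma inv_succ_pos n : (0 < / (INR n + 1))%R.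
Proof. apply Rinv_0_lt_compat. pose proof (pos_INR n). lra. Qed.

Lemma inv_succ_lt n m : (/ (INR m + 1) < / (INR n + 1))%R <-> n < m.
Proof.
  pose proof (pos_INR n) as pn. pose proof (pos_INR m) as pm. split; intros H.
  - destruct (le_lt_dec m n) as [L|L]; [|exact L].
    apply le_INR in L.
    assert (/ (INR n + 1) <= / (INR m + 1))%R by (apply Rinv_le_contravar; lra). lra.
  - apply lt_INR in H. apply Rinv_lt_contravar; [|lra].
    apply Rmult_lt_0_compat; lra.
Qed.

Lemma inv_succ_arch eps : (eps > 0)%R -> exists n, (/ (INR n + 1) < eps)%R.
Proof.
  intros He. destruct (archimed_cor1 eps He) as [N [HN Np]].
  exists N. apply lt_INR in Np. simpl in Np.
  assert (/ (INR N + 1) <= / INR N)%R by (apply Rinv_le_contravar; lra). lra.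
Qed.

Section PolishFromEquivalences.

Variables (X : Type) (E : nat -> X -> X -> Prop).
Hypothesis E_refl : forall n x, E n x x.
Hypothesis E_sym : forall n x y, E n x y -> E n y x.
Hypothesis E_trans : forall n x y z, E n x y -> E n y z -> E n x z.
Hypothesis E_le : forall n m x y, n <= m -> E m x y -> E n x y.
Hypothesis E_sep : forall x y, (forall n, E n x y) -> x = y.
Hypothesis E_code : forall n, exists code : X -> nat, forall x y, code x = code y -> E n x y.
Hypothesis E_complete : forall u : nat -> X,
  (forall n, E n (u n) (u (S n))) -> exists l, forall n, E n (u n) l.

(** The distance is [1/(n+1)] for the least [n] at which [E n] separates the points, and 0 if there
    is none. *)
Lemma equivalences_distance : exists d : X -> X -> R,
  (forall x y, (0 <= d x y)%R) /\
  (forall n x y, (d x y < / (INR n + 1))%R <-> E n x y) /\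
  (forall x y, d x y = 0%R \/ exists n, ~ E n x y /\ d x y = (/ (INR n + 1))%R).
Proof.
  destruct (choice_fun (fun (xy : X * X) (r : R) =>
    (0 <= r)%R /\ (forall n, (r < / (INR n + 1))%R <-> E n (fst xy) (snd xy)) /\
    (r = 0%R \/ exists n, ~ E n (fst xy) (snd xy) /\ r = (/ (INR n + 1))%R))) as [d Hd].
  { intros [x y]; simpl. destruct (classic (x = y)) as [->|ne].
    - exists 0%R. split; [lra|]. split; [|left; reflexivity].
      intros n. pose proof (inv_succ_pos n). split; intros; [apply E_refl|lra].
    - assert (Hn : exists n, ~ E n x y).
      { apply not_all_ex_not. intros H. apply ne, E_sep, H. }
      assert (Hm : exists n, ~ E n x y /\ forall m, m < n -> E m x y).
      { destruct Hn as [n Hn]. revert Hn.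
        induction n as [n IH] using (well_founded_induction Nat.lt_wf_0). intros Hn.
        destruct (classic (exists m, m < n /\ ~ E m x y)) as [[m [lm Hm]]|N].
        - exact (IH m lm Hm).
        - exists n. split; [exact Hn|]. intros m lm. apply NNPP. intros C.
          apply N. exists m. split; assumption. }
      destruct Hm as [n [Hne Hlt]]. exists (/ (INR n + 1))%R.
      pose proof (inv_succ_pos n). split; [lra|]. split.
      + intros m. rewrite inv_succ_lt. split; [apply Hlt|]. intros Em.
        destruct (le_lt_dec n m) as [L|L]; [|exact L].
        destruct Hne. exact (E_le _ _ _ _ L Em).
      + right. exists n. split; [exact Hne|reflexivity]. }
  exists (fun x y => d (x, y)).
  split; [intros x y; apply (Hd (x, y))|].
  split; [intros n x y; apply (Hd (x, y))|intros x y; apply (Hd (x, y))].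
Qed.

Lemma polish_of_equivalences : exists d : X -> X -> R,
  polish d /\ forall n x y, (d x y < / (INR n + 1))%R -> E n x y.
Proof.
  destruct equivalences_distance as [d [d0 [dE dv]]].
  exists d. split; [|intros n x y; apply dE].
  assert (dge : forall n x y, ~ E n x y -> (/ (INR n + 1) <= d x y)%R).
  { intros n x y H. apply Rnot_lt_le. intros L. apply H, dE, L. }
  split; [split; [|split]|split].
  - intros x y. split.
    + intros H. apply E_sep. intros n. apply dE. rewrite H. apply inv_succ_pos.
    + intros ->. destruct (dv y y) as [H|[n [H _]]]; [exact H|]. destruct H. apply E_refl.
  - assert (H : forall x y, (d x y <= d y x)%R).
    { intros x y. destruct (dv x y) as [->|[n [H ->]]]; [apply d0|].
      apply dge. intros H'. apply H, E_sym, H'. }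
    intros x y. apply Rle_antisym; apply H.
  - intros x y z. pose proof (d0 x y). pose proof (d0 y z).
    destruct (dv x z) as [->|[n [H' ->]]]; [lra|].
    (* By transitivity, if [E n] separates [x] from [z] then it separates one of the other two
       pairs, whose distance is then at least [1/(n+1)]. *)
    destruct (classic (E n x y)) as [Hxy|Hxy].
    + assert (~ E n y z) as Hyz by (intros Hyz; apply H'; exact (E_trans _ _ _ _ Hxy Hyz)).
      apply dge in Hyz. lra.
    + apply dge in Hxy. lra.
  - intros u Hu.
    destruct (choice_fun (fun n N => forall m m', N <= m -> N <= m' -> E n (u m) (u m')))
      as [N HN].
    { intros n. destruct (Hu _ (inv_succ_pos n)) as [N HN]. exists N.
      intros m m' lm lm'. apply dE, HN; assumption. }
    (* Partial sums of the Cauchy moduli dominate [N n] at both [n] and [n+1], so consecutive terms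
       of the subsequence are [E n]-related. *)
    set (M := fix M n := match n with 0 => N 0 | S n => M n + N (S n) end).
    assert (HM : forall n, N n <= M n /\ N n <= M (S n)).
    { intros n. assert (N n <= M n) by (destruct n; simpl; lia). simpl. lia. }
    destruct (E_complete (fun n => u (M n))) as [l Hl].
    { intros n. apply HN; apply HM. }
    exists l. intros eps He. destruct (inv_succ_arch eps He) as [n Hn].
    exists (M n). intros m lm.
    enough (d (u m) l < / (INR n + 1))%R by lra.
    apply dE. apply E_trans with (u (M n)); [|apply Hl].
    pose proof (HM n). apply HN; lia.
  - destruct (choice_fun _ E_code) as [code Hcode].
    (* The countable dense set consists of one representative for each code at each level; [r n x]
       depends on [x] only through its code. *)
    set (r := fun n x => epsilon (inhabits x) (fun y => code n y = code n x)).
    assert (Hr : forall n x, code n (r n x) = code n x).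
    { intros n x. unfold r. apply (epsilon_spec (inhabits x) (fun y => code n y = code n x)).
      exists x. reflexivity. }
    assert (Hrr : forall n x y, code n x = code n y -> r n x = r n y).
    { intros n x y H. unfold r. rewrite H. f_equal. apply proof_irrelevance. }
    exists (fun y => exists nx : nat * X, y = r (fst nx) (snd nx)). split.
    (* A point may be a representative at several levels; recording one level with the code there
       already determines it. *)
    + destruct (choice_fun (fun (y : X) (k : nat) =>
        (exists nx : nat * X, y = r (fst nx) (snd nx)) ->
        exists n x, y = r n x /\ k = to_nat (n, code n x))) as [k Hk].
      { intros y. destruct (classic (exists nx : nat * X, y = r (fst nx) (snd nx)))
          as [[[n x] Hy]|N].
        - exists (to_nat (n, code n x)). intros _. exists n, x. split; [exact Hy|reflexivity].
        - exists 0. intros H. destruct (N H). }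
      exists k. intros y y' Hy Hy' Hkk.
      destruct (Hk y Hy) as [n [x [-> Hn]]]. destruct (Hk y' Hy') as [n' [x' [-> Hn']]].
      rewrite Hn, Hn' in Hkk. apply to_nat_inj in Hkk. injection Hkk as -> Hc.
      apply Hrr. exact Hc.
    + intros x eps He. destruct (inv_succ_arch eps He) as [n Hn].
      exists (r n x). split; [exists (n, x); reflexivity|].
      enough (d x (r n x) < / (INR n + 1))%R by lra.
      apply dE, Hcode. symmetry. apply Hr.
Qed.

End PolishFromEquivalences.

(** * Borel families *)

Section BorelFamilies.

Context {G : Type}.

Lemma Borel_empty : Borel (fun _ : G -> bool => False).
Proof. apply Borel_open. intros A []. Qed.

Lemma Borel_const_and (P : Prop) (S : gfamily G) : Borel S -> Borel (fun A => P /\ S A).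
Proof.
  intros HS. destruct (classic P) as [p|np].
  - apply Borel_ext with S; [exact HS|]. intros A; tauto.
  - apply Borel_ext with (fun _ => False); [apply Borel_empty|]. intros A; tauto.
Qed.

Lemma Borel_or (S T : gfamily G) : Borel S -> Borel T -> Borel (fun A => S A \/ T A).
Proof.
  intros HS HT.
  apply Borel_ext with (fun A => exists n, (match n with 0 => S | _ => T end) A).
  - apply Borel_union. intros [|n]; assumption.
  - intros A. split.
    + intros [[|n] H]; [left|right]; exact H.
    + intros [H|H]; [exists 0|exists 1]; exact H.
Qed.

(** Continuity for the product topology, tested coordinate by coordinate. *)
Definition cont_map (phi : (G -> bool) -> (G -> bool)) : Prop :=
  forall A g, exists l : list G, forall B, (forall h, In h l -> B h = A h) -> phi B g = phi A g.

Lemma Borel_preimage (phi : (G -> bool) -> (G -> bool)) (S : gfamily G) :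
  cont_map phi -> Borel S -> Borel (fun A => S (phi A)).
Proof.
  intros Hphi HS. induction HS as [U HU|S HS IH|S HS IH|S T HS IH HST].
  - apply Borel_open. intros A HA. destruct (HU _ HA) as [l Hl].
    assert (Hk : exists k : list G, forall B, (forall h, In h k -> B h = A h) ->
                   forall g, In g l -> phi B g = phi A g).
    { clear Hl. induction l as [|g l [k Hk]].
      - exists nil. intros B _ g [].
      - destruct (Hphi A g) as [k' Hk']. exists (k' ++ k). intros B HB g' [<-|Hg'].
        + apply Hk'. intros h Hh. apply HB, in_or_app. left. exact Hh.
        + apply Hk; [|exact Hg']. intros h Hh. apply HB, in_or_app. right. exact Hh. }
    destruct Hk as [k Hk]. exists k. intros B HB. apply Hl. intros g Hg. exact (Hk B HB g Hg).
  - apply (Borel_compl _ IH).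
  - apply (Borel_union _ IH).
  - apply Borel_ext with (fun A => S (phi A)); [exact IH|]. intros A. apply HST.
Qed.

(** De Morgan, with the union taken over codes; a code attained by no index contributes the empty
    family. *)
Lemma Borel_countable_inter (I : Type) (code : I -> nat) (S : I -> gfamily G) :
  (forall i j, code i = code j -> i = j) ->
  (forall i, Borel (S i)) -> Borel (fun A => forall i, S i A).
Proof.
  intros inj HS.
  apply Borel_ext with (fun A => ~ exists n, exists i, code i = n /\ ~ S i A).
  - apply Borel_compl, Borel_union. intros n.
    destruct (classic (exists i, code i = n)) as [[i Hi]|N].
    + apply Borel_ext with (fun A => ~ S i A); [apply Borel_compl, HS|].
      intros A. split.
      * intros H. exists i. split; assumption.
      * intros [j [Hj H]]. rewrite <- Hj in Hi. apply inj in Hi. subst. exact H.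
    + apply Borel_ext with (fun _ => False); [apply Borel_empty|].
      intros A. split; [tauto|]. intros [i [Hi _]]. apply N. exists i. exact Hi.
  - intros A. split.
    + intros H i. apply NNPP. intros C. apply H. exists (code i), i. split; [reflexivity|exact C].
    + intros H [n [i [_ C]]]. apply C, H.
Qed.

End BorelFamilies.

(** * Projections of closed sets *)

Section Suslin.

Context {G : Type} (c : G -> nat) (c_inj : forall x y, c x = c y -> x = y).

Definition agree (n : nat) (A B : G -> bool) : Prop := forall g, c g < n -> A g = B g.

(** Closedness in the product of [2^G] with Baire space, expressed through basic neighbourhoods. *)
Definition jclosed (C : (G -> bool) -> (nat -> nat) -> Prop) : Prop :=
  forall A p,
    (forall n, exists B q, agree n A B /\ (forall k, k < n -> p k = q k) /\ C B q) -> C A p.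

Definition suslin (S : gfamily G) : Prop :=
  exists C, jclosed C /\ forall A, S A <-> exists p, C A p.

Lemma open2_agree (U : gfamily G) A :
  open2 U -> U A -> exists n, forall B, agree n A B -> U B.
Proof.
  intros HU HA. destruct (HU A HA) as [l Hl].
  assert (Hn : exists n, forall g, In g l -> c g < n).
  { clear Hl. induction l as [|g l [n Hn]].
    - exists 0. intros g [].
    - exists (n + S (c g)). intros h [<-|Hh]; [lia|]. specialize (Hn h Hh). lia. }
  destruct Hn as [n Hn]. exists n. intros B HB. apply Hl. intros g Hg.
  symmetry. apply HB, Hn, Hg.
Qed.

Lemma suslin_ext (S T : gfamily G) : same_family S T -> suslin S -> suslin T.
Proof.
  intros H [C [HC HS]]. exists C. split; [exact HC|]. intros A. rewrite <- HS. symmetry. apply H.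
Qed.

(* The witness is the length of an initial segment of [A] that forces membership. *)
Lemma suslin_open (U : gfamily G) : open2 U -> suslin U.
Proof.
  intros HU. exists (fun A p => forall B, agree (p 0) A B -> U B). split.
  - intros A p H B HB. destruct (H (S (p 0))) as [A' [q [HA [Hq HC]]]].
    apply HC. rewrite <- (Hq 0) by lia. intros g Hg.
    rewrite <- (HA g) by lia. apply HB. exact Hg.
  - intros A. split.
    + intros HA. destruct (open2_agree U A HU HA) as [n Hn]. exists (fun _ => n). exact Hn.
    + intros [p Hp]. apply Hp. intros g _. reflexivity.
Qed.

Lemma suslin_compl_open (U : gfamily G) : open2 U -> suslin (fun A => ~ U A).
Proof.
  intros HU. exists (fun A _ => ~ U A). split.
  - intros A p H HA. destruct (open2_agree U A HU HA) as [n Hn].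
    destruct (H n) as [B [q [HB [_ N]]]]. apply N, Hn, HB.
  - intros A. split.
    + intros H. exists (fun _ => 0). exact H.
    + intros [_ H]. exact H.
Qed.

(** The first entry of a witness selects the member of the union. *)
Lemma suslin_union (S : nat -> gfamily G) :
  (forall n, suslin (S n)) -> suslin (fun A => exists n, S n A).
Proof.
  intros HS. destruct (choice_fun _ HS) as [C HC].
  exists (fun A p => C (p 0) A (fun k => p (Datatypes.S k))). split.
  - intros A p H. apply (proj1 (HC (p 0))). intros n.
    destruct (H (Datatypes.S n)) as [B [q [HB [Hq Hc]]]].
    exists B, (fun k => q (Datatypes.S k)). split; [|split].
    + intros g Hg. apply HB. lia.
    + intros k Hk. apply Hq. lia.
    + rewrite (Hq 0) by lia. exact Hc.
  - intros A. split.
    + intros [n Hn]. apply (proj2 (HC n)) in Hn. destruct Hn as [p Hp].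
      exists (fun k => match k with 0 => n | Datatypes.S k => p k end). exact Hp.
    + intros [p Hp]. exists (p 0). apply (proj2 (HC (p 0))). eexists. exact Hp.
Qed.

(** One witness packs a witness for every member through the pairing function. A finite part of a
    row involves only a finite prefix of the packed sequence, whence closedness. *)
Lemma suslin_inter (S : nat -> gfamily G) :
  (forall n, suslin (S n)) -> suslin (fun A => forall n, S n A).
Proof.
  intros HS. destruct (choice_fun _ HS) as [C HC].
  exists (fun A p => forall i, C i A (fun k => p (to_nat (i, k)))). split.
  - intros A p H i. apply (proj1 (HC i)). intros n.
    destruct (bounded_below (fun k => to_nat (i, k)) n) as [N HN].
    destruct (H (n + Datatypes.S N)) as [B [q [HB [Hq Hc]]]].
    exists B, (fun k => q (to_nat (i, k))). split; [|split].
    + intros g Hg. apply HB. lia.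
    + intros k Hk. apply Hq. specialize (HN k). lia.
    + apply Hc.
  - intros A. split.
    + intros H. destruct (choice_fun (fun i p => C i A p)) as [p Hp].
      { intros i. apply (proj2 (HC i)), H. }
      exists (fun m => p (fst (of_nat m)) (snd (of_nat m))). intros i.
      replace (fun k => _) with (p i); [apply Hp|].
      extensionality k. rewrite cancel_of_to. reflexivity.
    + intros [p Hp] i. apply (proj2 (HC i)). eexists. apply Hp.
Qed.

(** The two claims go together because complementation swaps them; the complement of a union becomes
    a countable intersection. *)
Lemma Borel_suslin (S : gfamily G) : Borel S -> suslin S /\ suslin (fun A => ~ S A).
Proof.
  intros HS. induction HS as [U HU|S _ [IH1 IH2]|S _ IH|S T _ [IH1 IH2] HST].
  - split; [apply suslin_open|apply suslin_compl_open]; exact HU.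
  - split; [exact IH2|]. apply suslin_ext with S; [|exact IH1].
    intros A. split; [tauto|apply NNPP].
  - split.
    + apply suslin_union. intros n. apply IH.
    + apply suslin_ext with (fun A => forall n, ~ S n A).
      * intros A. split; [intros H [n Hn]; exact (H n Hn)|].
        intros H n Hn. apply H. exists n. exact Hn.
      * apply (suslin_inter (fun n A => ~ S n A)). intros n. apply IH.
  - split.
    + apply suslin_ext with S; assumption.
    + apply suslin_ext with (fun A => ~ S A); [|exact IH2].
      intros A. rewrite (HST A). reflexivity.
Qed.

Lemma bounded_on_initial (h : G -> nat) (n : nat) : exists N, forall g, c g < n -> h g < N.
Proof.
  induction n as [|n [N HN]].
  - exists 0. intros g Hg. lia.
  - destruct (classic (exists g, c g = n)) as [[g Hg]|Hno].
    + exists (N + S (h g)). intros k Hk.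
      destruct (Nat.eq_dec (c k) n) as [e|ne].
      * replace k with g; [lia|]. apply c_inj. congruence.
      * specialize (HN k). lia.
    + exists N. intros k Hk. apply HN.
      assert (c k <> n) by (intros e; apply Hno; exists k; exact e). lia.
Qed.

Lemma agree_code (n : nat) :
  exists code : (G -> bool) -> nat, forall A B, code A = code B -> agree n A B.
Proof.
  induction n as [|n [code H]].
  - exists (fun _ => 0). intros A B _ g Hg. lia.
  - destruct (classic (exists g, c g = n)) as [[g Hg]|Hno].
    + exists (fun A => to_nat (code A, if A g then 1 else 0)).
      intros A B E k Hk. apply to_nat_inj in E. injection E as E1 E2.
      destruct (Nat.eq_dec (c k) n) as [e|ne].
      * replace k with g by (apply c_inj; congruence).
        destruct (A g), (B g); congruence.
      * apply (H A B E1). lia.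
    + exists code. intros A B E k Hk. apply (H A B E).
      assert (c k <> n) by (intros e; apply Hno; exists k; exact e). lia.
Qed.

End Suslin.

Lemma prefix_code {T : Type} (t : T -> nat) (t_inj : forall x y, t x = t y -> x = y) (n : nat) :
  exists code : (nat -> T) -> nat, forall p q, code p = code q -> forall k, k < n -> p k = q k.
Proof.
  induction n as [|n [code H]].
  - exists (fun _ => 0). intros; lia.
  - exists (fun p => to_nat (code p, t (p n))). intros p q E k Hk.
    apply to_nat_inj in E. injection E as E1 E2.
    destruct (Nat.eq_dec k n) as [->|ne]; [apply t_inj, E2|].
    apply (H p q E1). lia.
Qed.

Lemma square_code (n m : nat) :
  exists code : (nat -> nat -> nat) -> nat,
    forall p q, code p = code q -> forall i k, i < n -> k < m -> p i k = q i k.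
Proof.
  destruct (prefix_code (fun k : nat => k) (fun _ _ e => e) m) as [cm Hm].
  destruct (prefix_code (fun k : nat => k) (fun _ _ e => e) n) as [cn Hn].
  exists (fun p => cn (fun i => cm (p i))). intros p q E i k Hi Hk.
  apply (Hm (p i) (q i)); [|exact Hk]. exact (Hn _ _ E i Hi).
Qed.

(** * The iterates of tau *)

Section Tau.

Context {G : Type} (mul : G -> G -> G) (inv : G -> G).

Definition step (A : G -> bool) (q : G * G) : G -> bool :=
  inter (translate mul inv (fst q) A) (translate mul inv (snd q) A).

Fixpoint orbit (A : G -> bool) (s : nat -> G * G) (n : nat) : G -> bool :=
  match n with 0 => A | S n => step (orbit A s n) (s n) end.

Lemma step_cont q : cont_map (fun A => step A q).
Proof.
  intros A g. exists (mul (inv (fst q)) g :: mul (inv (snd q)) g :: nil).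
  intros B HB. unfold step, inter, translate. rewrite !HB by (simpl; tauto). reflexivity.
Qed.

Context (c : G -> nat) (c_inj : forall x y, c x = c y -> x = y).

Definition pair_code (q : G * G) : nat := to_nat (c (fst q), c (snd q)).

Lemma pair_code_inj q r : pair_code q = pair_code r -> q = r.
Proof.
  destruct q as [x y], r as [x' y']. intros E.
  unfold pair_code in E. apply to_nat_inj in E. simpl in E.
  injection E as E1 E2. f_equal; apply c_inj; assumption.
Qed.

Lemma Borel_tau (S : gfamily G) : Borel S -> Borel (tau mul inv S).
Proof.
  intros HS.
  (* A countable intersection over pairs of continuous preimages, with the implication phrased by
     negations so that closure under complements applies. *)
  apply Borel_ext with (fun A => forall q : G * G, ~ (fst q <> snd q /\ ~ S (step A q))).
  - apply (Borel_countable_inter (G * G) pair_code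
             (fun q A => ~ (fst q <> snd q /\ ~ S (step A q))) pair_code_inj).
    intros q. apply Borel_compl.
    apply (Borel_const_and _ (fun A => ~ S (step A q))), Borel_compl.
    apply (Borel_preimage (fun A => step A q)); [apply step_cont|exact HS].
  - intros A. split.
    + intros H x y ne. apply NNPP. intros N. apply (H (x, y)). split; assumption.
    + intros H [x y] [ne N]. apply N, H. exact ne.
Qed.

Lemma step_agree n q :
  exists N, forall A B, agree c N A B -> agree c n (step A q) (step B q).
Proof.
  destruct (bounded_on_initial c c_inj
    (fun g => c (mul (inv (fst q)) g) + c (mul (inv (snd q)) g)) n) as [N HN].
  exists N. intros A B H g Hg. specialize (HN g Hg). simpl in HN.
  unfold step, inter, translate. f_equal; apply H; lia.
Qed.

(** Joint continuity in the set and the directions: once [s'] shares the first [i] entries of [s],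
    both orbits apply the same continuous steps. *)
Lemma orbit_agree A s i n :
  exists N, forall A' s', agree c N A A' -> (forall k, k < N -> s k = s' k) ->
    agree c n (orbit A s i) (orbit A' s' i).
Proof.
  revert n. induction i as [|i IH]; intros n.
  - exists n. intros A' s' H _. exact H.
  - destruct (step_agree n (s i)) as [m Hm]. destruct (IH m) as [N HN].
    exists (N + S i). intros A' s' HA Hs. simpl. rewrite <- (Hs i) by lia.
    apply Hm, HN.
    + intros g Hg. apply HA. lia.
    + intros k Hk. apply Hs. lia.
Qed.

Lemma orbit_ext A s s' n : (forall k, k < n -> s k = s' k) -> orbit A s n = orbit A s' n.
Proof.
  induction n as [|n IH]; intros H; simpl; [reflexivity|].
  rewrite IH by (intros; apply H; lia). rewrite H by lia. reflexivity.
Qed.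

Variable F : gfamily G.
Hypothesis HI : left_invariant mul inv F.
Hypothesis HL : lower F.

(** Left invariance and lowerness put [F] inside [tau F], which makes the hierarchy increasing. *)
Lemma step_lower A q : F A -> F (step A q).
Proof.
  intros HA. apply HL with (translate mul inv (fst q) A); [apply HI, HA|].
  intros g Hg. unfold step, inter in Hg. apply andb_prop in Hg. apply Hg.
Qed.

Lemma InTau_OZ A : F A -> InTau mul inv F OZ A.
Proof. intros HA. apply InTau_zero; [constructor|exact HA]. Qed.

Lemma InTau_mono a b A : ole a b -> InTau mul inv F a A -> InTau mul inv F b A.
Proof.
  intros Hab HA. destruct HA as [a A Ha HA|a A Ha HA].
  - destruct (OZ_or_pos b) as [Hb|Hb]; [apply InTau_zero; assumption|].
    apply InTau_pos; [exact Hb|]. intros x y _. exists OZ. split; [exact Hb|].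
    apply InTau_OZ. exact (step_lower A (x, y) HA).
  - apply InTau_pos; [exact (olt_ole_trans _ _ _ Ha Hab)|].
    intros x y ne. destruct (HA x y ne) as [d [Hd H]].
    exists d. split; [exact (olt_ole_trans _ _ _ Hd Hab)|exact H].
Qed.

Lemma Borel_tau_iter (HB : Borel F) (a : Ord) : Borel (tau_iter mul inv F a).
Proof.
  (* The induction runs on strict lower levels: [lt (OL f)] is the union of the [lt (f n)], and by
     monotonicity [lt (OS a)] is level [a]. *)
  set (lt := fun a A => exists b, olt b a /\ InTau mul inv F b A).
  assert (Hiter : forall a, Borel (lt a) -> Borel (tau_iter mul inv F a)).
  { intros b Hb.
    apply Borel_ext with (fun A => (ole b OZ /\ F A) \/ (olt OZ b /\ tau mul inv (lt b) A)).
    - apply Borel_or; apply Borel_const_and; [exact HB|]. apply Borel_tau, Hb.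
    - intros A. split.
      + intros [[H1 H2]|[H1 H2]]; [apply InTau_zero|apply InTau_pos]; assumption.
      + intros H. destruct H as [b A H1 H2|b A H1 H2]; [left|right]; split; assumption. }
  apply Hiter. induction a as [|a IH|f IH].
  - apply Borel_ext with (fun _ => False); [apply Borel_empty|].
    intros A. split; [tauto|]. intros [b [Hb _]]. exact (not_olt_OZ b Hb).
  - apply Borel_ext with (tau_iter mul inv F a); [apply Hiter, IH|].
    intros A. split.
    + intros H. exists a. split; [constructor; apply ole_refl|exact H].
    + intros [b [Hb H]]. inversion Hb; subst. apply InTau_mono with b; assumption.
  - apply Borel_ext with (fun A => exists n, lt (f n) A); [apply Borel_union, IH|].
    intros A. split.
    + intros [n [b [Hb H]]]. exists b. split; [apply olt_L with n; exact Hb|exact H].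
    + intros [b [Hb H]]. inversion Hb; subst. exists n, b. split; assumption.
Qed.

(** The recursive premise of [InTau] sits under an existential, hence the explicit recursion on the
    derivation. *)
Lemma InTau_family_ind (P : (G -> bool) -> Prop) :
  (forall A, F A -> P A) ->
  (forall A, (forall x y, x <> y -> P (step A (x, y))) -> P A) ->
  forall a A, InTau mul inv F a A -> P A.
Proof.
  intros H0 H1. fix rec 3. intros a A H. destruct H as [a A _ HA|a A _ HA].
  - exact (H0 A HA).
  - apply H1. intros x y ne. destruct (HA x y ne) as [b [_ Hb]]. exact (rec b _ Hb).
Qed.

(** [OS (OL f)] lies strictly above every [f n], so one level absorbs countably many bounds; it is
    also positive, which covers steps landing in [F]. *)
Lemma InTau_succ_sup (f : nat -> Ord) A :
  (forall x y, x <> y ->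
     F (step A (x, y)) \/ exists n, InTau mul inv F (f n) (step A (x, y))) ->
  InTau mul inv F (OS (OL f)) A.
Proof.
  intros H. apply InTau_pos; [constructor; constructor|].
  intros x y ne. destruct (H x y ne) as [HF|[n Hn]].
  - exists OZ. split; [constructor; constructor|]. apply InTau_OZ, HF.
  - exists (f n). split; [constructor; apply ole_OL|exact Hn].
Qed.

(** Regularity of the first uncountable ordinal: there are countably many pairs, so the levels of
    all the steps have a common countable bound. *)
Lemma tau_omega1_closed A :
  tau mul inv (tau_omega1 mul inv F) A -> tau_omega1 mul inv F A.
Proof.
  intros H.
  destruct (choice_fun (fun n b => forall q, pair_code q = n -> fst q <> snd q ->
                                     InTau mul inv F b (step A q))) as [f Hf].
  { intros n. destruct (classic (exists q, pair_code q = n /\ fst q <> snd q)) as [[q [Hq ne]]|N].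
    - destruct (H _ _ ne) as [b Hb]. exists b. intros r Hr _.
      replace r with q; [exact Hb|]. apply pair_code_inj. congruence.
    - exists OZ. intros q Hq ne. destruct N. exists q. split; assumption. }
  exists (OS (OL f)). apply InTau_succ_sup. intros x y ne. right.
  exists (pair_code (x, y)). apply Hf; [reflexivity|exact ne].
Qed.

Lemma tau_omega1_is_tau_star : is_tau_star mul inv F (tau_omega1 mul inv F).
Proof.
  split; [|split].
  - intros A HA. exists OZ. apply InTau_OZ, HA.
  - intros A. split; [apply tau_omega1_closed|].
    intros [a H] x y ne. destruct H as [a A _ HA|a A _ HA].
    + exists OZ. apply InTau_OZ. exact (step_lower A (x, y) HA).
    + destruct (HA x y ne) as [b [_ Hb]]. exists b. exact Hb.
  - intros T HFT HT A [a H].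
    apply (InTau_family_ind T HFT) with (a := a); [|exact H].
    intros B HB. apply HT. intros x y ne. exact (HB x y ne).
Qed.

(** Outside [tau_omega1], closedness under [tau] supplies a step that stays outside, and dependent
    choice strings such steps together. Conversely, induction on membership excludes such sequences.
    Iterate 0 can be omitted: were [A] in [F], iterate 1 would be too. *)
Lemma not_tau_omega1_iff A :
  ~ tau_omega1 mul inv F A <->
  exists s, forall i, fst (s i) <> snd (s i) /\ ~ F (orbit A s (S i)).
Proof.
  split.
  - intros HA.
    destruct (dependent_choice (fun B => ~ tau_omega1 mul inv F B)
      (fun B B' => exists q, fst q <> snd q /\ B' = step B q) A HA) as [f [f0 Hf]].
    { intros B HB. apply NNPP. intros N. apply HB, tau_omega1_closed. intros x y ne.
      apply NNPP. intros C. apply N. exists (step B (x, y)). split; [exact C|].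
      exists (x, y). split; [exact ne|reflexivity]. }
    destruct (choice_fun _ (fun n => proj2 (Hf n))) as [s Hs].
    assert (Ho : forall n, orbit A s n = f n).
    { induction n as [|n IH]; simpl; [symmetry; exact f0|].
      rewrite IH. symmetry. apply Hs. }
    exists s. intros i. split; [apply Hs|]. rewrite Ho. intros HF.
    apply (proj1 (Hf (S i))). exists OZ. apply InTau_OZ, HF.
  - intros [s Hs] [a Ha].
    assert (HP : forall s, ~ forall i, fst (s i) <> snd (s i) /\ ~ F (orbit A s (S i)));
      [|exact (HP s Hs)].
    clear s Hs. revert a A Ha.
    apply (InTau_family_ind (fun A =>
      forall s, ~ forall i, fst (s i) <> snd (s i) /\ ~ F (orbit A s (S i)))).
    + intros A HA s Hs. apply (proj2 (Hs 0)). apply step_lower, HA.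
    + intros A IH s Hs.
      (* The tail of [s] would be a sequence of the excluded kind for the first iterate. *)
      apply (IH (fst (s 0)) (snd (s 0)) (proj1 (Hs 0)) (fun i => s (S i))).
      intros i. split; [apply Hs|].
      replace (orbit _ _ _) with (orbit A s (S (S i))); [apply Hs|].
      clear. rewrite <- surjective_pairing. generalize (S i) as n.
      induction n as [|n IH]; [reflexivity|].
      change (step (orbit A s (S n)) (s (S n)) =
              step (orbit (step A (s 0)) (fun i => s (S i)) n) (s (S n))).
      rewrite IH. reflexivity.
Qed.

(** * Configurations *)

(* [wit 0] is a witness for [base]; [wit (S i)] witnesses that the [S i]-th iterate avoids [F]. *)
Record config := Config { base : G -> bool; dirs : nat -> G * G; wit : nat -> nat -> nat }.

Definition ceq (n : nat) (z z' : config) : Prop :=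
  agree c n (base z) (base z') /\ (forall k, k < n -> dirs z k = dirs z' k) /\
  (forall i k, i < n -> k < n -> wit z i k = wit z' i k).

Lemma ceq_refl n z : ceq n z z.
Proof. split; [intros g _|split; intros]; reflexivity. Qed.

Lemma ceq_sym n z z' : ceq n z z' -> ceq n z' z.
Proof.
  intros [H1 [H2 H3]]. split; [intros g Hg|split; intros]; symmetry; auto.
Qed.

Lemma ceq_trans n x y z : ceq n x y -> ceq n y z -> ceq n x z.
Proof.
  intros [H1 [H2 H3]] [K1 [K2 K3]]. split; [|split].
  - intros g Hg. rewrite H1, K1 by exact Hg. reflexivity.
  - intros k Hk. rewrite H2, K2 by exact Hk. reflexivity.
  - intros i k Hi Hk. rewrite H3, K3 by assumption. reflexivity.
Qed.

Lemma ceq_le n m z z' : n <= m -> ceq m z z' -> ceq n z z'.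
Proof.
  intros L [H1 [H2 H3]]. split; [|split].
  - intros g Hg. apply H1. lia.
  - intros k Hk. apply H2. lia.
  - intros i k Hi Hk. apply H3; lia.
Qed.

Lemma ceq_sep z z' : (forall n, ceq n z z') -> z = z'.
Proof.
  destruct z as [A s w], z' as [A' s' w']. intros H. f_equal.
  - extensionality g. apply (proj1 (H (S (c g)))). lia.
  - extensionality k. apply (proj1 (proj2 (H (S k)))). lia.
  - extensionality i. extensionality k. apply (proj2 (proj2 (H (S (i + k))))); lia.
Qed.

Lemma ceq_code n : exists code : config -> nat, forall z z', code z = code z' -> ceq n z z'.
Proof.
  destruct (agree_code c c_inj n) as [ca Ha].
  destruct (prefix_code pair_code pair_code_inj n) as [cs Hs].
  destruct (square_code n n) as [cw Hw].
  exists (fun z => to_nat (ca (base z), to_nat (cs (dirs z), cw (wit z)))).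
  intros z z' E. apply to_nat_inj, pair_equal_spec in E. destruct E as [E1 E2].
  apply to_nat_inj in E2. injection E2 as E2 E3.
  split; [|split]; [apply Ha|apply Hs|apply Hw]; assumption.
Qed.

Lemma ceq_complete (u : nat -> config) :
  (forall n, ceq n (u n) (u (S n))) -> exists l, forall n, ceq n (u n) l.
Proof.
  intros Hu.
  assert (Hle : forall n m, n <= m -> ceq n (u n) (u m)).
  { intros n m L. induction L as [|m L IH]; [apply ceq_refl|].
    apply ceq_trans with (u m); [exact IH|]. apply ceq_le with m; [exact L|apply Hu]. }
  assert (Hlim : forall n k, k <= n -> ceq k (u n) (u k)).
  { intros n k L. apply ceq_sym, Hle, L. }
  (* Each coordinate is read at a stage where it is already frozen; [S (i + k)] exceeds both indices
     of a witness entry. *)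
  exists (Config (fun g => base (u (S (c g))) g) (fun k => dirs (u (S k)) k)
                 (fun i k => wit (u (S (i + k))) i k)).
  intros n. split; [|split]; simpl.
  - intros g Hg. apply (proj1 (Hlim n (S (c g)) Hg)). lia.
  - intros k Hk. apply (proj1 (proj2 (Hlim n (S k) Hk))). lia.
  (* Here the reading stage may lie past [n] although [i] and [k] are below [n]. *)
  - intros i k Hi Hk. destruct (le_lt_dec (S (i + k)) n) as [L|L].
    + apply (proj2 (proj2 (Hlim n _ L))); lia.
    + apply (proj2 (proj2 (Hle n (S (i + k)) ltac:(lia)))); assumption.
Qed.

Definition valid (K D : (G -> bool) -> (nat -> nat) -> Prop) (n : nat) (z : config) : Prop :=
  K (base z) (wit z 0) /\
  forall i, i < n ->
    fst (dirs z i) <> snd (dirs z i) /\ D (orbit (base z) (dirs z) (S i)) (wit z (S i)).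

(** Each single condition passes to the limit: directions are discrete, and continuity of [orbit]
    lets closedness of [D] be tested on approximations. *)
Lemma valid_closed K D z : jclosed c K -> jclosed c D ->
  (forall n, exists z', ceq n z z' /\ valid K D n z') -> forall n, valid K D n z.
Proof.
  intros HK HD H.
  (* Going [S i] levels deeper fixes direction [i] and the first [n] entries of witness row [i]. *)
  assert (Hw : forall n i, exists z', ceq n z z' /\ valid K D (n + S i) z' /\
                 dirs z i = dirs z' i /\ forall k, k < n -> wit z i k = wit z' i k).
  { intros n i. destruct (H (n + S i)) as [z' [E V]]. exists z'.
    split; [apply ceq_le with (n + S i); [lia|exact E]|].
    split; [exact V|]. destruct E as [_ [E2 E3]].
    split; [apply E2; lia|intros; apply E3; lia]. }
  intros m. split.
  - apply HK. intros n. destruct (Hw n 0) as [z' [E [V [_ Ew]]]].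
    exists (base z'), (wit z' 0). split; [apply E|]. split; [exact Ew|apply V].
  - intros i _. split.
    + destruct (Hw 0 i) as [z' [_ [V [Ed _]]]]. rewrite Ed. apply V. lia.
    + apply HD. intros n.
      destruct (orbit_agree (base z) (dirs z) (S i) n) as [N HN].
      destruct (Hw (N + n) (S i)) as [z' [E [V [_ Ew]]]].
      exists (orbit (base z') (dirs z') (S i)), (wit z' (S i)). split; [|split].
      * apply HN.
        -- intros g Hg. apply (proj1 E). lia.
        -- intros k Hk. apply (proj1 (proj2 E)). lia.
      * intros k Hk. apply Ew. lia.
      * apply V. lia.
Qed.

(** * Coanalyticity and boundedness *)

Lemma coanalytic_tau_omega1 : Borel F -> coanalytic (tau_omega1 mul inv F).
Proof.
  intros HB. destruct (proj2 (Borel_suslin c F HB)) as [D [HD HF]].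
  (* The trivial [K] leaves row 0 of the witness table free; the other rows certify that the
     iterates avoid [F]. *)
  set (V := valid (fun _ _ => True) D).
  set (X := {z : config | forall n, V n z}).
  destruct (polish_of_equivalences X (fun n x y => ceq n (proj1_sig x) (proj1_sig y)))
    as [d [Hd HdE]].
  - intros n x. apply ceq_refl.
  - intros n x y. apply ceq_sym.
  - intros n x y z. apply ceq_trans.
  - intros n m x y. apply ceq_le.
  - intros [x Hx] [y Hy] H. simpl in H. apply ceq_sep in H. subst y.
    f_equal. apply proof_irrelevance.
  - intros n. destruct (ceq_code n) as [code Hc].
    exists (fun x => code (proj1_sig x)). intros x y. apply Hc.
  - intros u Hu. destruct (ceq_complete (fun n => proj1_sig (u n)) Hu) as [l Hl].
    assert (Vl : forall n, V n l).
    { apply valid_closed; [intros A p _; exact I|exact HD|]. intros n.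
      exists (proj1_sig (u n)). split; [apply ceq_sym, Hl|]. apply (proj2_sig (u n)). }
    exists (exist _ l Vl). exact Hl.
  - exists X, d, (fun x => base (proj1_sig x)). split; [exact Hd|]. split.
    (* Within this radius, all coordinates with code below [S (c g)] agree, that of [g] included. *)
    + intros x g. exists (/ (INR (S (c g)) + 1))%R. split; [apply inv_succ_pos|].
      intros y Hy. apply HdE in Hy. symmetry. apply (proj1 Hy). lia.
    + intros A. rewrite not_tau_omega1_iff. split.
      * intros [s Hs].
        destruct (choice_fun (fun i p => D (orbit A s (S i)) p)) as [w Hw].
        { intros i. apply HF, Hs. }
        assert (Vz : forall n,
          V n (Config A s (fun i => match i with 0 => fun _ => 0 | S i => w i end))).
        { intros n. split; [exact I|]. intros i _. split; [apply Hs|apply Hw]. }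
        exists (exist _ _ Vz). reflexivity.
      * intros [[z Hz] Ez]. simpl in Ez.
        assert (base z = A) as <- by (extensionality g; apply Ez).
        exists (dirs z). intros i.
        destruct (proj2 (Hz (S i)) i ltac:(lia)) as [H1 H2]. split; [exact H1|].
        apply HF. eexists. exact H2.
Qed.

(* Nodes of the tree of approximations are pairs [(n, z)] with [z] regarded up to [ceq n]. *)
Lemma tau_omega1_bounded (S0 : gfamily G) : suslin c S0 -> Borel F ->
  Defs.subfamily S0 (tau_omega1 mul inv F) -> exists a, Defs.subfamily S0 (tau_iter mul inv F a).
Proof.
  intros [K [HK HS]] HB Hsub.
  destruct (proj2 (Borel_suslin c F HB)) as [D [HD HF]].
  destruct (classic (exists A, S0 A)) as [[A0 HA0]|Hno];
    [|exists OZ; intros A HA; destruct Hno; exists A; exact HA].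
  (* [q0] fills the directions that a node of depth 0 ignores; if there is no pair, every set lies
     in level 1 vacuously. *)
  destruct (classic (exists q : G * G, True)) as [[q0 _]|Hq].
  2:{ exists (OS OZ). intros A _. apply InTau_pos; [constructor; constructor|].
      intros x y. destruct Hq. exists (x, y). exact I. }
  set (child := fun t u : nat * config =>
    fst t = S (fst u) /\ valid K D (fst t) (snd t) /\ ceq (fst u) (snd t) (snd u)).
  set (z0 := Config A0 (fun _ => q0) (fun _ _ => 0)).
  assert (Hacc : Acc child (0, z0)).
  { apply NNPP. intros N. destruct (not_Acc_descending _ _ N) as [f [f0 Hf]].
    assert (Hn : forall n, fst (f n) = n).
    { induction n as [|n IH]; [rewrite f0; reflexivity|].
      rewrite (proj1 (Hf n)), IH. reflexivity. }
    destruct (ceq_complete (fun n => snd (f n))) as [l Hl].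
    { intros n. apply ceq_sym. rewrite <- (Hn n) at 1. apply Hf. }
    (* Validity is read one node further along the branch, because the root itself is not known to
       be valid. *)
    assert (Vl : forall n, valid K D n l).
    { apply valid_closed; [exact HK|exact HD|]. intros n. exists (snd (f (S n))). split.
      - apply ceq_le with (S n); [lia|]. apply ceq_sym, Hl.
      - destruct (Hf n) as [_ [[V1 V2] _]]. rewrite Hn in V2.
        split; [exact V1|]. intros i Hi. apply V2. lia. }
    assert (Hin : S0 (base l)) by (apply HS; eexists; apply (Vl 0)).
    apply Hsub in Hin. revert Hin. apply not_tau_omega1_iff.
    exists (dirs l). intros i. destruct (proj2 (Vl (S i)) i ltac:(lia)) as [H1 H2].
    split; [exact H1|]. apply HF. eexists. exact H2. }
  (* Well-founded induction on the tree yields one bound for all configurations that a node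
     approximates. *)
  assert (Hbound : forall t, Acc child t -> exists a, forall z,
    valid K D (fst t) z -> ceq (fst t) z (snd t) ->
    InTau mul inv F a (orbit (base z) (dirs z) (fst t))).
  { intros t Ht. induction Ht as [[n t] _ IH]. simpl.
    (* Codes at resolution [S n] sort the extensions into countably many classes; any representative
       is a child whose bound serves its whole class. *)
    destruct (ceq_code (S n)) as [code Hcode].
    destruct (choice_fun (fun k a => forall z, valid K D (S n) z -> ceq n z t -> code z = k ->
      InTau mul inv F a (orbit (base z) (dirs z) (S n)))) as [f Hf].
    { intros k.
      destruct (classic (exists z, valid K D (S n) z /\ ceq n z t /\ code z = k))
        as [[y [Vy [Ey Cy]]]|N].
      - destruct (IH (S n, y)) as [a Ha]; [split; [reflexivity|split; assumption]|].
        exists a. intros z Vz _ Cz. apply Ha; [exact Vz|]. apply Hcode. simpl. congruence.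
      - exists OZ. intros z Vz Ez Cz. destruct N. exists z. tauto. }
    exists (OS (OL f)). intros z [Vz1 Vz2] Ez. apply InTau_succ_sup. intros x y ne.
    set (B := step (orbit (base z) (dirs z) n) (x, y)).
    destruct (classic (F B)) as [HFB|HFB]; [left; exact HFB|right].
    apply HF in HFB. destruct HFB as [p Hp].
    (* Appending the pair and its witness alters only direction [n] and row [S n], both invisible at
       resolution [n], so [z'] still extends the node. *)
    set (z' := Config (base z)
      (fun k => if Nat.eq_dec k n then (x, y) else dirs z k)
      (fun i => if Nat.eq_dec i (S n) then p else wit z i)).
    assert (Hd : forall i, i <= n -> orbit (base z') (dirs z') i = orbit (base z) (dirs z) i).
    { intros i Hi. apply orbit_ext. intros k Hk. simpl.
      destruct (Nat.eq_dec k n); [lia|reflexivity]. }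
    assert (HSn : orbit (base z') (dirs z') (S n) = B).
    { change (step (orbit (base z') (dirs z') n) (dirs z' n) = B).
      rewrite Hd by lia. simpl. destruct (Nat.eq_dec n n); [reflexivity|lia]. }
    exists (code z'). rewrite <- HSn. apply Hf; [| |reflexivity].
    - split; [exact Vz1|]. intros i Hi. destruct (Nat.eq_dec i n) as [->|Hne].
      + rewrite HSn. simpl. destruct (Nat.eq_dec n n) as [_|]; [|lia].
        split; [exact ne|exact Hp].
      + rewrite Hd by lia.
        cbn [dirs wit z']. destruct (Nat.eq_dec i n); [lia|].
        destruct (Nat.eq_dec (S i) (S n)); [lia|]. apply Vz2. lia.
    - apply ceq_trans with z; [|exact Ez]. split; [|split].
      + intros g _. reflexivity.
      + intros k Hk. simpl. destruct (Nat.eq_dec k n); [lia|reflexivity].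
      + intros i k Hi _. cbn [wit z']. destruct (Nat.eq_dec i (S n)); [lia|reflexivity]. }
  (* Resolution 0 imposes no agreement and iterate 0 is the set itself, so the bound at the root
     covers every member of [S0]. *)
  destruct (Hbound _ Hacc) as [a Ha]. exists a. intros A HA.
  apply HS in HA. destruct HA as [p Hp].
  apply (Ha (Config A (fun _ => q0) (fun _ => p))).
  - split; [exact Hp|]. simpl. intros; lia.
  - split; [|split]; simpl; try (intros; lia). intros g Hg. lia.
Qed.

End Tau.

Theorem theorem7p1 (G : Type) (mul : G -> G -> G) (one : G) (inv : G -> G)
  (Hgrp : is_group mul one inv) (Hcount : countable_type G)
  (F : gfamily G) (HB : Borel F) (HI : left_invariant mul inv F) (HL : lower F) :
  (forall alpha : Ord, Borel (tau_iter mul inv F alpha)) /\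
  (is_tau_star mul inv F (tau_omega1 mul inv F) /\ coanalytic (tau_omega1 mul inv F)) /\
  ((forall alpha : Ord, ~ same_family (tau_omega1 mul inv F) (tau_iter mul inv F alpha)) ->
   ~ Borel (tau_omega1 mul inv F)).
Proof.
  destruct Hcount as [c c_inj]. split; [|split; [split|]].
  - intros alpha. apply (Borel_tau_iter mul inv c c_inj F HI HL HB).
  - apply (tau_omega1_is_tau_star mul inv c c_inj F HI HL).
  - apply (coanalytic_tau_omega1 mul inv c c_inj F HI HL HB).
  - intros H HBs.
    destruct (tau_omega1_bounded mul inv c c_inj F HI HL (tau_omega1 mul inv F)) as [a Ha].
    + apply (Borel_suslin c _ HBs).
    + exact HB.
    + intros A HA. exact HA.
    + apply (H a). intros A. split; [apply Ha|]. intros HA. exists a. exact HA.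
Qed.
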